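(* Let $X$ be a nonzero finite-dimensional real vector space with norm $\rho$ and dual norm $\rho_*$. Let $\phi:[0,\infty)\to\mathbb{R}$ be finite, convex, and nondecreasing, with $L:=\lim_{r\to\infty}\phi(r)/r\in(0,\infty)$. Assume that $\gamma:=\lim_{r\to\infty}(\phi(r)-Lr)$ is finite and that $\phi(r)-Lr\neq\gamma$ for every $r\ge0$, and set $d(r)=\phi(r)-Lr-\gamma>0$. Let $a>0$ and $b\in X^*$ with $\rho_*(b)=aL$, and for $R\ge0$ let $$v_R=\inf\{at+b(z):(t,z)\in\mathbb{R}\times X,\ t\ge\phi(\rho(z)),\ \rho(z)\le R\}.$$ Then for every $R\ge0$, $$v_R=a\gamma+a\,d(R).$$ If, in addition, $d(r)\sim\kappa r^{-\nu}$ as $r\to\infty$ for some $\nu>0$ and $\kappa>0$, then $$v_R-a\gamma\sim a\kappa R^{-\nu}\qquad(R\to\infty).$$ Consequently, under this additional assumption, defining $R_\eta=\inf\{R\ge0: v_R-a\gamma\le\eta\}$, the smallest admissible budget satisfies $$R_\eta\sim\left(\frac{a\kappa}{\eta}\right)^{1/\nu}\qquad(\eta\downarrow0).$$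
   Context: The dual norm is $\rho_*(b)=\sup\{b(z):\rho(z)\le1\}$. $A\sim B$ means that the ratio $A/B$ tends to $1$ in the indicated limit. *)

(* Defs.v *)
From HB Require Import structures.
From mathcomp Require Import all_boot all_order all_algebra.
From mathcomp Require Import all_classical all_reals all_analysis.

Set Implicit Arguments.
Unset Strict Implicit.
Unset Printing Implicit Defensive.

Import Order.TTheory GRing.Theory Num.Theory.
Import numFieldNormedType.Exports.

Local Open Scope classical_set_scope.
Local Open Scope ring_scope.

(* Nonnegativity follows from these axioms. *)
Record is_norm (R : realType) (X : lmodType R) (rho : X -> R) : Prop := IsNorm {
  is_norm_triangle : forall x y, rho (x + y) <= rho x + rho y;
  is_norm_scale : forall (c : R) x, rho (c *: x) = `|c| * rho x;
  is_norm_eq0 : forall x, rho x = 0 -> x = 0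
}.

Definition dual_norm (R : realType) (X : lmodType R) (rho : X -> R)
    (b : {scalar X}) : \bar R :=
  ereal_sup [set (b z)%:E | z in [set z | rho z <= 1]].

(* The infimum is taken in the extended reals, so that it is the true infimum
   even when the feasible set is empty (+oo) or the objective is unbounded. *)
Definition budget_value (R : realType) (X : lmodType R) (rho : X -> R)
    (phi : R -> R) (a : R) (b : {scalar X}) (r : R) : \bar R :=
  ereal_inf [set (a * p.1 + b p.2)%:E |
    p in [set p : R * X | phi (rho p.2) <= p.1 /\ rho p.2 <= r]].

Definition min_budget (R : realType) (v : R -> \bar R) (c eta : R) : \bar R :=
  ereal_inf [set r%:E | r in [set r | 0 <= r /\ (v r - c%:E <= eta%:E)%E]].

(* The ratio is extended-real, so A may take infinite values a priori. *)
Definition asymp_equiv (R : realType) (A : R -> \bar R) (B : R -> R)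
    (F : set_system R) : Prop :=
  (A x / (B x)%:E)%E @[x --> F] --> 1%E.

(* Main.v *)
(** For a feasible point [(t, z)], [a t + b z >= a (phi (rho z) - L rho z)], with
    near-equality when [t = phi (rho z)] and [- b] is nearly maximal in the
    direction [z].  A convex function with a finite limit at infinity is
    nonincreasing, so [phi r - L r] decreases to [gamma] and the infimum over
    [rho z <= r] is [a (phi r - L r)].  The asymptotics of the minimal budget
    invert the power law: with [s = (C / eta)^(1/nu)], the point [(1 + e) s] is
    admissible because the ratio of the gap to [C r^-nu] is eventually at most
    [(1 + e)^nu > 1], and no admissible point lies below [(1 - e) s] because the
    ratio is eventually at least [(1 - e)^nu < 1]. *)
Require Import Defs.
From HB Require Import structures.
From mathcomp Require Import all_boot all_order all_algebra.
From mathcomp Require Import all_classical all_reals all_analysis.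
From mathcomp Require Import ring lra.

Import Order.TTheory GRing.Theory Num.Theory.
Import numFieldNormedType.Exports.

Set Implicit Arguments.
Unset Strict Implicit.
Unset Printing Implicit Defensive.

Local Open Scope classical_set_scope.
Local Open Scope ring_scope.

(** Real bounds on both sides force the extended-real ratio to be finite, so its limit can be
    handled by estimates on real numbers. *)
Lemma asymp_equiv_bounds (R : realType) (A : R -> \bar R) (B : R -> R)
    (F : set_system R) : Filter F ->
  asymp_equiv A B F <->
  forall e : R, 0 < e < 1 ->
    \forall x \near F, ((1 - e)%:E <= A x / (B x)%:E <= (1 + e)%:E)%E.
Proof.
move=> FF; rewrite /asymp_equiv; split.
  move=> /fine_cvgP[Afin /cvgrPdist_le A1] e /andP[e0 _].
  near=> x.
  have xfin : (A x / (B x)%:E)%E \is a fin_num by near: x.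
  rewrite -(fineK xfin) !lee_fin.
  have : `|1 - fine (A x / (B x)%:E)%E| <= e by near: x; exact: A1.
  by rewrite ler_norml => /andP[? ?]; apply/andP; split; lra.
move=> bnd; apply/fine_cvgP; split.
  have h : 0 < (2^-1 : R) < 1 by apply/andP; split; lra.
  apply: filterS (bnd _ h) => x /andP[lo up].
  by rewrite fin_real// (lt_le_trans (ltNyr _) lo) (le_lt_trans up (ltry _)).
apply/cvgrPdist_le => e e0.
(* The bounds are available only for tolerances below 1, hence the cap at 1/2. *)
pose m := Num.min e 2^-1.
have m0 : 0 < m < 1 by rewrite lt_min gt_min e0/=; apply/andP; split; [lra|apply/orP; right; lra].
have me : m <= e by rewrite ge_min lexx.
apply: filterS (bnd _ m0) => x /andP[lo up] /=.
have xfin : (A x / (B x)%:E)%E \is a fin_num.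
  by rewrite fin_real// (lt_le_trans (ltNyr _) lo) (le_lt_trans up (ltry _)).
move: lo up; rewrite -(fineK xfin) !lee_fin => lo up.
by rewrite ler_norml; apply/andP; split; lra.
Unshelve. all: by end_near. Qed.

(** Monotonicity of chord slopes from [x], with denominators cleared so that polynomial arithmetic
    can use it directly. *)
Lemma convex_function_chord (R : realType) (phi : R -> R) (x y z : R) :
  convex_function (`[0, +oo[%classic : set R^o) phi ->
  0 <= x -> x < y -> y < z ->
  (phi y - phi x) * (z - x) <= (phi z - phi x) * (y - x).
Proof.
move=> phi_convex x0 xy yz.
have zx : 0 < z - x by lra.
pose t := (z - y) / (z - x).
have t01 : Itv.spec (@Itv.num_sem R) (Itv.Real `[0%Z, 1%Z]) t.
  rewrite /Itv.spec/= /Itv.num_sem/= num_real/= in_itv/=.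
  by apply/andP; split; [rewrite divr_ge0|rewrite ler_pdivrMr// mul1r]; lra.
have := phi_convex (Itv.mk t01) x z.
rewrite !inE/= !in_itv/= !andbT => /(_ x0) /(_ ltac:(lra)).
rewrite convRE /conv/= /unstable.onem.
have -> : t *: (x : R^o) + (1 - t) *: (z : R^o) = y :> R.
  by rewrite /GRing.scale/= /t; field; lra.
move=> h.
have -> : (phi y - phi x) * (z - x) = phi y * (z - x) - phi x * (z - x) by ring.
have : phi y * (z - x) <= (t * phi x + (1 - t) * phi z) * (z - x).
  by rewrite ler_pM2r.
have -> : (t * phi x + (1 - t) * phi z) * (z - x) =
   phi x * (z - y) + phi z * (y - x) by rewrite /t; field; lra.
lra.
Qed.

(** A rise [s > 0] between [x] and [y] would, by convexity, persist as at least linear growth beyond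
    [y], against the finite limit. *)
Lemma convex_sub_asymptote_nonincr (R : realType) (phi : R -> R) (L gamma : R) :
  convex_function (`[0, +oo[%classic : set R^o) phi ->
  phi r - L * r @[r --> +oo] --> gamma ->
  forall x y : R, 0 <= x -> x <= y -> phi y - L * y <= phi x - L * x.
Proof.
move=> phi_convex gamma_lim x y x0; rewrite le_eqVlt => /predU1P[-> //|xy].
rewrite leNgt; apply/negP => lt_xy.
pose s := (phi y - L * y) - (phi x - L * x).
have s0 : 0 < s by rewrite subr_gt0.
(* The line through the points at [x] and [y] exceeds [gamma + 1] once [z > x + D * (y - x) / s],
   while the function is eventually at most [gamma + 1]. *)
pose D := gamma + 1 - (phi x - L * x).
near (pinfty_nbhs R) => z.
have yz : y < z by near: z; exact: (nbhs_pinfty_gt (num_real _)).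
have zD : x + D * (y - x) / s < z by near: z; exact: (nbhs_pinfty_gt (num_real _)).
have zg : phi z - L * z <= gamma + 1.
  by near: z; apply: (cvgr_le _ gamma_lim); lra.
have := convex_function_chord phi_convex x0 xy yz.
have : D * (y - x) < (z - x) * s by rewrite -ltr_pdivrMr//; lra.
have : 0 <= (gamma + 1 - (phi z - L * z)) * (y - x).
  by rewrite mulr_ge0//; lra.
rewrite /D /s; nra.
Unshelve. all: by end_near. Qed.

Lemma is_norm_ge0 (R : realType) (X : lmodType R) (rho : X -> R) (x : X) :
  is_norm rho -> 0 <= rho x.
Proof.
move=> [tri scale _].
have := tri x (- x); rewrite subrr -scaleN1r scale normrN1 mul1r.
have := scale 0 0; rewrite scale0r normr0 mul0r => ->; lra.
Qed.

Lemma dual_norm_le (R : realType) (X : lmodType R) (rho : X -> R)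
    (b : {scalar X}) (c : R) (z : X) :
  is_norm rho -> dual_norm rho b = c%:E -> b z <= c * rho z.
Proof.
move=> rho_norm bc.
have : 0 <= rho z by exact: is_norm_ge0.
rewrite le_eqVlt => /predU1P[z0|z_gt0].
  by rewrite -z0 mulr0 (is_norm_eq0 rho_norm (esym z0)) linear0.
rewrite -ler_pdivrMr// -lee_fin -bc; apply: ereal_sup_ubound.
exists ((rho z)^-1 *: z) => /=.
  by rewrite (is_norm_scale rho_norm) gtr0_norm ?invr_gt0// mulVf// gt_eqF.
by rewrite linearZ/= mulrC.
Qed.

Lemma dual_norm_adherent (R : realType) (X : lmodType R) (rho : X -> R)
    (b : {scalar X}) (c e : R) :
  dual_norm rho b = c%:E -> 0 < e -> exists2 z, rho z <= 1 & c - e < b z.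
Proof.
move=> bc e0.
have [|_ [z z1 <-]] := ub_ereal_sup_adherent e0 (_ : dual_norm rho b \is a fin_num).
  by rewrite bc.
by rewrite -/(dual_norm rho b) bc -EFinB lte_fin; exists z.
Qed.

(* Attainment of the dual norm is not needed: near-maximizers of [b] on the
   unit ball, scaled by [- r], already give the upper bound on the infimum. *)
Lemma budget_valueE (R : realType) (X : lmodType R) (rho : X -> R)
    (phi : R -> R) (L a : R) (b : {scalar X}) (r : R) :
  is_norm rho ->
  {in `[0, +oo[ &, {homo phi : x y / x <= y}} ->
  (forall x y : R, 0 <= x -> x <= y -> phi y - L * y <= phi x - L * x) ->
  0 < a -> dual_norm rho b = (a * L)%:E -> 0 <= r ->
  budget_value rho phi a b r = (a * (phi r - L * r))%:E.
Proof.
move=> rho_norm phi_nondecr phiL_nonincr a0 bL r0.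
apply/eqP; rewrite eq_le; apply/andP; split; last first.
  apply: le_ereal_inf_tmp => _ [[t z]/= [tz zr] <-]; rewrite lee_fin.
  have z0 := is_norm_ge0 z rho_norm.
  (* Applied to [- z], the dual norm bounds [b z] from below by [- a * L * rho z]. *)
  have := dual_norm_le (- z) rho_norm bL.
  rewrite linearN -scaleN1r (is_norm_scale rho_norm) normrN1 mul1r => bz.
  have : a * (phi r - L * r) <= a * (phi (rho z) - L * rho z).
    by rewrite ler_pM2l//; exact: phiL_nonincr.
  have : a * phi (rho z) <= a * t by rewrite ler_pM2l.
  lra.
apply/lee_addgt0Pr => e e0.
(* Scaling by [r] turns this error into at most [e]; the [+ 1] covers [r = 0]. *)
have e'0 : 0 < e / (r + 1) by rewrite divr_gt0//; lra.
have [z z1 bz] := dual_norm_adherent bL e'0.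
have rz : rho (- r *: z) <= r.
  rewrite (is_norm_scale rho_norm) normrN ger0_norm//.
  by rewrite -[leRHS]mulr1 ler_wpM2l.
apply: ge_ereal_inf; exists (a * phi r + b (- r *: z))%:E.
  exists (phi r, - r *: z) => //=; split => //.
  by apply: phi_nondecr => //; rewrite in_itv/= andbT// is_norm_ge0.
rewrite linearZ/= -EFinD lee_fin.
have : r * (a * L - e / (r + 1)) <= r * b z by rewrite ler_wpM2l// ltW.
have : r * (e / (r + 1)) <= e by rewrite mulrCA ler_piMr ?ltW// ltr_pdivrMr; lra.
lra.
Qed.

(** The power law controls [g] only at large radii; positivity and monotonicity of [g] exclude the
    small ones from admissibility when [eta] is small. *)
Lemma min_budget_asymp (R : realType) (v : R -> \bar R) (g : R -> R)
    (c nu C : R) :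
  0 < nu -> 0 < C ->
  (forall x, 0 <= x -> 0 < g x) ->
  (forall x y, 0 <= x -> x <= y -> g y <= g x) ->
  (forall x, 0 <= x -> v x = (c + g x)%:E) ->
  asymp_equiv (fun r => (g r)%:E) (fun r => C * r `^ (- nu)) +oo ->
  asymp_equiv (min_budget v c) (fun eta => (C / eta) `^ nu^-1) 0^'+.
Proof.
move=> nu0 C0 g_gt0 g_nonincr vE /fine_cvgP[_ gC].
apply/asymp_equiv_bounds => e /andP[e0 e1].
have one_nu : 1 `^ nu = 1 :> R by rewrite powR1.
have q1 : 1 < (1 + e) `^ nu.
  by rewrite -[ltLHS]one_nu gt0_ltr_powR// ?nnegrE; lra.
have q2 : (1 - e) `^ nu < 1.
  by rewrite -[ltRHS]one_nu gt0_ltr_powR// ?nnegrE; lra.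
have [M [_ MP]] := filterI (cvgr_le _ gC _ q1) (cvgr_ge _ gC _ q2).
have {}MP : forall x, M < x -> 0 < x ->
    (1 - e) `^ nu * C <= g x * x `^ nu <= (1 + e) `^ nu * C.
  move=> x Mx x0; have /= := MP x Mx.
  have xnu : 0 < x `^ nu by exact: powR_gt0.
  have -> : fine ((g x)%:E / (C * x `^ (- nu))%:E)%E = g x * x `^ nu / C.
    rewrite inver powRN gt_eqF/= ?mulr_gt0 ?invr_gt0//.
    by field; rewrite !gt_eqF.
  by rewrite ler_pdivlMr// ler_pdivrMr// => -[-> ->].
pose M0 := Num.max M 1.
have M01 : 1 <= M0 by rewrite le_max lexx orbT.
have MM0 : M <= M0 by rewrite le_max lexx.
have M0nu : 0 < M0 `^ nu by apply: powR_gt0; lra.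
near=> eta.
have eta0 : 0 < eta by near: eta; exact: nbhs_right_gt.
(* This puts [s] beyond [M0]; the next bound makes every radius up to [M0] inadmissible. *)
have eta_M0 : eta < C / M0 `^ nu.
  by near: eta; apply: nbhs_right_lt; rewrite divr_gt0.
have eta_g : eta < g M0 by near: eta; apply: nbhs_right_lt; apply: g_gt0; lra.
have Ceta : 0 < C / eta by rewrite divr_gt0.
set s := (C / eta) `^ nu^-1.
have s0 : 0 < s by exact: powR_gt0.
have sK : s `^ nu = C / eta by rewrite -powRrM mulVf ?gt_eqF// powRr1// ltW.
have sM0 : M0 < s.
  rewrite ltNge; apply/negP => sM0.
  have := ge0_ler_powR (ltW nu0) (ltW s0 : s \is Num.nneg) (_ : M0 \is Num.nneg) sM0.
  rewrite nnegrE sK => /(_ ltac:(lra)).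
  by rewrite ler_pdivrMr// mulrC leNgt -ltr_pdivlMr// eta_M0.
rewrite inver gt_eqF// lee_pdivlMr// lee_pdivrMr// -!EFinM.
apply/andP; split.
  apply: le_ereal_inf_tmp => _ [r [r0 +] <-]; rewrite vE// -EFinB !lee_fin.
  rewrite addrAC subrr add0r => gr.
  have M0r : M0 < r.
    rewrite ltNge; apply/negP => rM0.
    by have := g_nonincr _ _ r0 rM0; lra.
  have rgt0 : 0 < r by lra.
  have /andP[lo _] := MP r (le_lt_trans MM0 M0r) rgt0.
  (* If [r < (1 - e) * s], then [eta * r ^ nu < (1 - e) ^ nu * C <= g r * r ^ nu <= eta * r ^ nu], a
     contradiction. *)
  rewrite leNgt; apply/negP => rs.
  have := gt0_ltr_powR nu0 (_ : r \is Num.nneg) (_ : (1 - e) * s \is Num.nneg) rs.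
  rewrite !nnegrE r0 mulr_ge0 ?subr_ge0 ?ltW// => /(_ isT isT).
  rewrite (powRM nu (_ : 0 <= 1 - e) (ltW s0)); last by lra.
  rewrite sK mulrA ltr_pdivlMr// mulrC.
  have : g r * r `^ nu <= eta * r `^ nu by rewrite ler_wpM2r// powR_ge0.
  lra.
have r0 : 0 < (1 + e) * s by rewrite mulr_gt0//; lra.
apply: ereal_inf_lbound; exists ((1 + e) * s) => //; split; first exact: ltW.
rewrite (vE _ (ltW r0)) -EFinB lee_fin addrAC subrr add0r.
have Mr : M < (1 + e) * s.
  have : 0 < e * s by rewrite mulr_gt0.
  lra.
(* With [x = (1 + e) * s], the upper bound [(1 + e) ^ nu * C] equals [eta * x ^ nu], so cancelling
   [x ^ nu] leaves [g x <= eta]. *)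
have /andP[_] := MP _ Mr r0.
rewrite (powRM nu (_ : 0 <= 1 + e) (ltW s0)); last by lra.
have -> : (1 + e) `^ nu * C = eta * ((1 + e) `^ nu * s `^ nu).
  by rewrite sK; field; rewrite gt_eqF.
by rewrite ler_pM2r// mulr_gt0 ?powR_gt0//; lra.
Unshelve. all: by end_near. Qed.

Unset Implicit Arguments.

Theorem theorem6p3 (R : realType) (X : vectType R) (rho : X -> R)
    (phi : R -> R) (L gamma a : R) (b : {scalar X})
    (d : R -> R) (v : R -> \bar R)
    (X_neq0 : (0 < \dim {:X})%N)
    (rho_norm : is_norm rho)
    (phi_convex : convex_function (`[0, +oo[%classic : set R^o) phi)
    (phi_nondecr : {in `[0, +oo[ &, {homo phi : x y / x <= y}})
    (L_lim : phi r / r @[r --> +oo] --> L)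
    (L_gt0 : 0 < L)
    (gamma_lim : phi r - L * r @[r --> +oo] --> gamma)
    (gamma_neq : forall r : R, 0 <= r -> phi r - L * r != gamma)
    (d_def : d = fun r => phi r - L * r - gamma)
    (a_gt0 : 0 < a)
    (b_norm : dual_norm rho b = (a * L)%:E)
    (v_def : v = budget_value rho phi a b) :
  [/\ forall r : R, 0 <= r -> 0 < d r,
      forall r : R, 0 <= r -> v r = (a * gamma + a * d r)%:E
    & forall nu kappa : R, 0 < nu -> 0 < kappa ->
      asymp_equiv (fun r => (d r)%:E) (fun r => kappa * r `^ (- nu)) +oo ->
      asymp_equiv (fun r => v r - (a * gamma)%:E)%E
                  (fun r => a * kappa * r `^ (- nu)) +oo
      /\ asymp_equiv (min_budget v (a * gamma))
                     (fun eta => (a * kappa / eta) `^ (nu^-1)) 0^'+].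
Proof.
have phiL_nonincr := convex_sub_asymptote_nonincr phi_convex gamma_lim.
(* A nonincreasing function stays above its limit; [gamma_neq] makes this strict. *)
have d_gt0 r : 0 <= r -> 0 < d r.
  move=> r0; rewrite d_def lt_neqAle eq_sym subr_eq0 gamma_neq//= subr_ge0.
  apply: (cvgr_to_le gamma_lim).
  apply: filterS (nbhs_pinfty_ge (num_real r)) => x; exact: phiL_nonincr.
have vE r : 0 <= r -> v r = (a * gamma + a * d r)%:E.
  move=> r0; rewrite v_def (budget_valueE rho_norm phi_nondecr phiL_nonincr)//.
  by rewrite d_def; congr EFin; ring.
split=> // nu kappa nu0 kappa0 d_asymp.
(* The common factor [a] cancels in the ratio, so this is the assumed equivalence for [d]. *)
have ad_asymp : asymp_equiv (fun r => (a * d r)%:E)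
    (fun r => a * kappa * r `^ (- nu)) +oo.
  apply: cvg_trans d_asymp; apply: near_eq_cvg.
  near=> r.
  have r0 : 0 < r by near: r; exact: (nbhs_pinfty_gt (num_real _)).
  have rnu : 0 < r `^ (- nu) by exact: powR_gt0.
  rewrite !inver !gt_eqF ?mulr_gt0// -!EFinM; congr EFin.
  by field; rewrite !gt_eqF.
split.
  apply: cvg_trans ad_asymp; apply: near_eq_cvg.
  near=> r.
  rewrite vE; last by near: r; exact: (nbhs_pinfty_ge (num_real _)).
  by rewrite -EFinB addrAC subrr add0r.
apply: (min_budget_asymp nu0 _ _ _ vE ad_asymp).
- by rewrite mulr_gt0.
- by move=> x x0; rewrite mulr_gt0// d_gt0.
- move=> x y x0 xy; rewrite ler_pM2l// d_def lerD2r.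
  exact: phiL_nonincr.
Unshelve. all: by end_near. Qed.
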